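(* Let $X$ be a locally compact, non-compact Hausdorff space, with one-point compactification $\alpha X = X \cup \{\star\}$. Suppose $X$ is pseudoradial and $\alpha X$ is radial at $\star$. Then every ordinal compactification of $X$ is pseudoradial.
   Context: A transfinite sequence is a net whose domain is (nonempty and) well-ordered. A space $Z$ is radial at $z$ if for every $A \subseteq Z$ with $z \in \overline{A}$ there is a transfinite sequence with range in $A$ converging to $z$. A space $Z$ is pseudoradial if for every non-closed $A \subseteq Z$ there is a transfinite sequence in $A$ converging to a point of $Z \setminus A$. A compactification of $X$ is a compact Hausdorff space $\gamma X$ containing $X$ as a dense subspace; it is an ordinal compactification if its remainder $\gamma X \setminus X$ is homeomorphic to some ordinal (with the order topology). $\star$ denotes the point at infinity of $\alpha X$. *)

(* Defs.v *)
From mathcomp Require Import all_boot all_order.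
From mathcomp Require Import all_classical.
From mathcomp Require wochoice.
From mathcomp Require Import topology.

Set Implicit Arguments.
Unset Strict Implicit.
Unset Printing Implicit Defensive.

Local Open Scope classical_set_scope.

Definition tails {d} (I : orderType d) : set_system I :=
  filter_from [set: I] (fun i => [set j | (i <= j)%O]).

Arguments tails {d} I.

Definition transfinite_sequence_cvg {Z : topologicalType} (A : set Z) (z : Z) :=
  exists (d : Order.disp_t) (I : orderType d) (s : I -> Z),
    [/\ wochoice.well_order (<=%O : rel I), [set: I] !=set0,
        range s `<=` A & s @ tails I --> z].

Definition radial_at (Z : topologicalType) (z : Z) :=
  forall A : set Z, closure A z -> transfinite_sequence_cvg A z.

Arguments radial_at Z z : clear implicits.

Definition pseudoradial (Z : topologicalType) :=
  forall A : set Z, ~ closed A ->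
    exists2 z, (~` A) z & transfinite_sequence_cvg A z.

Definition embedding {X Y : topologicalType} (e : X -> Y) :=
  injective e /\
  forall U : set X, open U <-> exists2 V : set Y, open V & e @^-1` V = U.

Definition homeomorphic (S T : topologicalType) :=
  exists (f : S -> T) (g : T -> S),
    [/\ continuous f, continuous g, cancel f g & cancel g f].

(* Ordinals are represented, up to order isomorphism, by well-ordered types;
   the order topology does not depend on the representative. *)
Definition homeomorphic_to_ordinal (S : topologicalType) :=
  exists (d : Order.disp_t) (K : orderType d),
    wochoice.well_order (<=%O : rel K) /\ homeomorphic S (order_topology K).

(* The inclusion of X in its compactification Y is the embedding e. *)
Definition compactification (X Y : topologicalType) (e : X -> Y) :=
  [/\ compact [set: Y], hausdorff_space Y, embedding e & dense (range e)].

Definition remainder {X Y : topologicalType} (e : X -> Y) : topologicalType :=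
  set_type (~` range e).

Definition ordinal_compactification (X Y : topologicalType) (e : X -> Y) :=
  compactification e /\ homeomorphic_to_ordinal (remainder e).

(* Main.v *)
Require Import Defs.
From HB Require Import structures.
From mathcomp Require Import all_boot all_order.
From mathcomp Require Import all_classical.
From mathcomp Require Import interval.
From mathcomp Require wochoice.
From mathcomp Require Import topology.
Import Order.TTheory.

Local Open Scope classical_set_scope.

(** Write [K] for the remainder, which is compact because [X], being locally
    compact and dense, is open in [Y].  Let [A] be non-closed in [Y].  If the
    trace of [A] on [X] or on [K] is not closed there, then a transfinite
    sequence is provided by pseudoradiality of [X] or of the ordinal [K].
    Otherwise let [p] be the least point of [K] in [closure (A `&` X) `\` A].
    By minimality of [p] some open interval [`]q, p]] of [K] meets
    [closure (A `&` X)] in [p] only; as [p] lies outside the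
    compact set [K `\` `]q, p]], [A `&` X] has a subset [B], its trace on a
    small neighbourhood of [p], whose closure meets [K] in [p] only.
    Sequences in [B] tending to the point at infinity then converge to [p]. *)

Section well_ordered.
Context {d : Order.disp_t} {K : orderType d}.
Hypothesis K_wo : wochoice.well_order (<=%O : rel K).

Lemma well_order_min (A : set K) :
  A !=set0 -> exists2 m, A m & forall x, A x -> (m <= x)%O.
Proof.
move=> [a Aa].
have [|m [[/asboolP Am mA] _]] := K_wo (fun x => `[< A x >]).
  by exists a; exact/asboolP.
by exists m => // x Ax; apply: mA; exact/asboolP.
Qed.

(** If [p] is not maximal, this is the open ray below the successor [s] of [p]; otherwise it is the
    whole space. *)
Lemma well_order_open_le (p : K) :
  open ([set x | (x <= p)%O] : set (order_topology K)).
Proof.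
have [[q pq]|pmax] := pselect (exists q, (p < q)%O).
  have [s ps sP] := @well_order_min [set x | (p < x)%O] (ex_intro _ q pq).
  have := @lray_open _ (order_topology K) s; rewrite set_itvE; congr open.
  apply/seteqP; split=> x /=; last by move=> xp; exact: le_lt_trans ps.
  by move=> xs; rewrite leNgt; apply/negP => /sP; rewrite leNgt xs.
rewrite (_ : mkset _ = setT); first exact: openT.
apply/seteqP; split=> x //= _; rewrite leNgt; apply/negP => px.
by apply: pmax; exists x.
Qed.

(** Cut a basic open interval around [p] off at [p]. The last clause makes [C] absorb whole tails of
    any increasing sequence below [p]. *)
Lemma well_order_nbhs_le (p : order_topology K) (O : set (order_topology K)) :
  nbhs p O -> exists C : set (order_topology K),
    [/\ open C, C p, C `<=` O, forall x, C x -> (x <= p)%O &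
        forall x y, C x -> (x <= y)%O -> (y <= p)%O -> C y].
Proof.
rewrite itv_nbhsE => -[i [oi pi] iO].
exists ([set` i] `&` [set x | (x <= p)%O]); split.
- by apply: openI; [exact: itv_open_ends_open | exact: well_order_open_le].
- by split => /=.
- by move=> x [/iO].
- by move=> x [].
- move=> x y [/= xi _] xy yp; split=> //=; move: i pi xi {oi iO} => [l r].
  rewrite !itv_boundlr => /andP[_ pr] /andP[lx _]; apply/andP; split.
    by apply: le_trans lx _; rewrite bnd_simp.
  by apply: le_trans pr; rewrite bnd_simp.
Qed.

End well_ordered.

Definition suborder {d : Order.disp_t} {K : orderType d} (P : pred K) : Type :=
  {x : K | P x}.

Section suborder.
Context {d : Order.disp_t} {K : orderType d} (P : pred K).
HB.instance Definition _ := SubChoice.on (suborder P).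
HB.instance Definition _ := [SubChoice_isSubOrder of suborder P by <: with d].

Lemma suborder_well_order : wochoice.well_order (<=%O : rel K) ->
  wochoice.well_order (<=%O : rel (suborder P)).
Proof.
move=> K_wo; apply: wochoice.antisymmetric_well_order; first exact: le_anti.
move=> A [a aA].
have [|_ [m mA <-] mP] := @well_order_min _ _ K_wo (val @` [set` A]).
  by exists (val a); exists a.
by exists m; split=> // x xA; rewrite leEsub; apply: mP; exists x.
Qed.

End suborder.

(** A point [p] of the closure outside [A] is approached by [A] from below only, so the elements of
    [A] below [p], indexed by themselves, converge to [p]. *)
Lemma well_order_pseudoradial (d : Order.disp_t) (K : orderType d) :
  wochoice.well_order (<=%O : rel K) -> pseudoradial (order_topology K).
Proof.
move=> K_wo A; rewrite /closed => /existsNP[p /not_implyP[clAp nAp]].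
exists p => //.
pose P (x : K) := `[< A x >] && (x < p)%O.
have cof (O : set (order_topology K)) : nbhs p O ->
    exists i : suborder P, forall j : suborder P, (i <= j)%O -> O (val j).
  move=> /(well_order_nbhs_le K_wo)[C [oC Cp CO Cle Cup]].
  have [a [Aa Ca]] := clAp _ (open_nbhs_nbhs (conj oC Cp)).
  have Pa : P a.
    rewrite /P asboolT //= lt_neqAle (Cle _ Ca) andbT.
    by apply/eqP => ap; apply: nAp; rewrite -ap.
  exists (exist _ a Pa) => j; rewrite leEsub /= => aj.
  by apply/CO/(Cup _ _ Ca aj)/ltW; case/andP: (valP j).
exists d, (suborder P), val; split.
- exact: suborder_well_order.
- by have [i _] := cof setT filterT; exists i.
- by move=> _ [i _ <-]; case/andP: (valP i) => /asboolP.
- by move=> O /cof[i iO]; exists i.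
Qed.

Lemma transfinite_sequence_cvg_image {S T : topologicalType} (f : S -> T)
    (A : set S) (B : set T) (z : S) :
  {for z, continuous f} -> f @` A `<=` B ->
  transfinite_sequence_cvg A z -> transfinite_sequence_cvg B (f z).
Proof.
move=> fz fAB [d [I [s [Iwo I0 sA sz]]]].
exists d, I, (f \o s); split=> //.
  by move=> _ [i _ <-]; apply: fAB; exists (s i) => //; apply: sA; exists i.
by move=> O /fz /sz.
Qed.

Section embedding.
Context {X Y : topologicalType} (e : X -> Y).
Hypothesis e_emb : embedding e.

Lemma embedding_continuous : continuous e.
Proof. by apply/continuousP => V oV; apply/e_emb.2; exists V. Qed.

Lemma embedding_nbhs (x : X) (N : set X) :
  nbhs x N -> exists2 V, nbhs (e x) V & e @^-1` V `<=` N.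
Proof.
rewrite nbhsE => -[U [oU Ux] UN].
have [V oV VU] := (e_emb.2 U).1 oU.
exists V; last by rewrite VU.
by apply: open_nbhs_nbhs; split=> //; rewrite -VU in Ux.
Qed.

(** A filter on the preimage is pushed forward to [Q]; its cluster point has the form [e x], and [x]
    is a cluster point upstairs. *)
Lemma embedding_compact_preimage (Q : set Y) :
  compact Q -> Q `<=` range e -> compact (e @^-1` Q).
Proof.
move=> cQ Qe F PF FQ.
have [y [Qy Fy]] := cQ (e @ F) _ FQ.
have [x _ xy] := Qe _ Qy; rewrite -{}xy in Qy Fy.
exists x; split=> // M N FM /embedding_nbhs[V nV VN].
have FeM : (e @ F) (e @` M).
  by apply: (@filterS _ F _ M _ _ FM) => z Mz; exists z.
have [_ [[z Mz <-] Vz]] := Fy _ _ FeM nV.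
by exists z; split=> //; exact: VN.
Qed.

(** A compact neighbourhood [N] of [x] has closed image, and [e @] N[contains the trace on]range
    e[of some open]W[around]e x[. By density]W[lies in the closure of that trace, hence in]e
    @[N]. *)
Lemma locally_compact_open_range : locally_compact [set: X] ->
  hausdorff_space Y -> dense (range e) -> open (range e).
Proof.
move=> lcX hY dn; rewrite openE => _ [x _ <-].
have [N + [cN _]] := lcX x Logic.I.
rewrite withinET => /embedding_nbhs[V + VN].
rewrite nbhsE => -[W [oW Wx] WV]; rewrite /interior nbhsE.
exists W; first by split.
have cleN : closed (e @` N).
  apply: compact_closed => //; apply: continuous_compact => //.
  exact/continuous_subspaceT/embedding_continuous.
suff : W `<=` e @` N by move=> WeN y /WeN[z _ <-]; exists z.
move=> y Wy; apply: cleN => O; rewrite nbhsE => -[O' [oO' O'y] O'O].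
have O'W0 : O' `&` W !=set0 by exists y.
have [u [[O'u Wu] [z _ zu]]] := dn _ O'W0 (openI oO' oW).
rewrite -{}zu in O'u Wu.
by exists (e z); split; [exists z => //; exact/VN/WV | exact: O'O].
Qed.

Lemma radial_at_infinity_cvg (B : set X) (p : Y) :
  compact [set: Y] -> hausdorff_space Y ->
  radial_at (one_point_compactification X) None ->
  ~ range e p -> closure (e @` B) p ->
  closure (e @` B) `<=` p |` range e ->
  transfinite_sequence_cvg (e @` B) p.
Proof.
move=> cY hY radX nep clBp clB.
have clstar : closure (Some @` B : set (one_point_compactification X)) None.
  (* Otherwise [B] lies in a compact [Q], whose closed image would contain [p]. *)
  move=> M [Q [cQ _] QM]; apply: contrapT => BM0.
  apply: nep; have BQ : B `<=` Q.
    move=> x Bx; apply: contrapT => nQx; apply: BM0; exists (Some x).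
    by split; [exists x | apply: QM; left; exists x].
  have cleQ : closed (e @` Q).
    apply: compact_closed => //; apply: continuous_compact => //.
    exact/continuous_subspaceT/embedding_continuous.
  have [x _ <-] : (e @` Q) p.
    by apply: cleQ; apply: closureS clBp; exact: image_subset.
  by exists x.
have [d [I [s [Iwo I0 sB sN]]]] := radX _ clstar.
have /choice[t tP] : forall i, exists x, B x /\ Some x = s i.
  by move=> i; have [|x Bx xs] := sB (s i); [exists i | exists x].
exists d, I, (e \o t); split=> //.
  by move=> _ [i _ <-]; exists (t i) => //; exact: (tP i).1.
move=> O; rewrite nbhsE => -[V [oV Vp] VO].
have cQ : closed (closure (e @` B) `\` V).
  by apply: closedI; [exact: closed_closure | exact: open_closedC].
have Q_infty : nbhs (None : one_point_compactification X)
    (Some @` (~` (e @^-1` (closure (e @` B) `\` V))) `|` [set None]).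
  exists (e @^-1` (closure (e @` B) `\` V)) => //; split.
    apply: embedding_compact_preimage.
      by apply: subclosed_compact cQ cY _.
    by move=> y [/clB[->|//] nV].
  by apply: preimage_closed => // x _; exact: embedding_continuous.
have [i _ iP] := sN _ Q_infty.
exists i => // j /iP /=; rewrite -(tP j).2 => -[[x nQ [xt]]|//].
apply: VO; apply: contrapT => nV; apply: nQ; rewrite xt; split=> //.
by apply: subset_closure; exists (t j) => //; exact: (tP j).1.
Qed.

End embedding.

Theorem theorem3p6 (X : topologicalType)
  (X_locally_compact : locally_compact [set: X])
  (X_noncompact : ~ compact [set: X])
  (X_hausdorff : hausdorff_space X)
  (X_pseudoradial : pseudoradial X)
  (star_radial : radial_at (one_point_compactification X) None) :
  forall (Y : topologicalType) (e : X -> Y),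
    ordinal_compactification e -> pseudoradial Y.
Proof.
move=> Y e [[cY hY e_emb e_dense] [d [K [K_wo [f [g [fc gc fK gK]]]]]]] A nclA.
have ec := embedding_continuous e e_emb.
have oe := locally_compact_open_range e e_emb X_locally_compact hY e_dense.
pose i (k : order_topology K) : Y := set_val (g k).
have ic : continuous i.
  move=> k; apply: continuous_comp; first exact: gc.
  exact: initial_continuous.
have iNe k : ~ range e (i k) by have /set_mem := valP (g k).
have iK y : ~ range e y -> exists k, y = i k.
  move=> ney; pose r : remainder e := exist _ y (mem_set ney).
  by exists (f r); rewrite /i fK.
have i_inj : injective i.
  by move=> k l /val_inj/(can_inj gK).
(* Since [range e] is open, the remainder is closed in [Y], and so are its relatively closed
   subsets. *)
have i_closed (C : set (order_topology K)) : closed C -> closed (i @` C).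
  move=> cC; rewrite (_ : i @` C = set_val @` (f @^-1` C)); last first.
    apply/seteqP; split=> [_ [k Ck <-]|_ [r Cr <-]].
      by exists (g k) => //=; rewrite gK.
    by exists (f r) => //; rewrite /i fK.
  have : closed (f @^-1` C) by apply: preimage_closed => // x _; exact: fc.
  move/closed_openC => -[V oV VC].
  rewrite (_ : _ @` _ = ~` V `&` ~` range e).
    by apply: closedI; exact: open_closedC.
  have VE r : V (set_val r) <-> ~ (f @^-1` C) r.
    by rewrite -[~ _]/((~` _) r) -VC.
  apply/seteqP; split=> [_ [r Cr <-]|y [nVy ney]].
    by split; [move=> /VE | have /set_mem := valP r].
  pose r : remainder e := exist _ y (mem_set ney).
  by exists r => //; apply: contrapT => /VE.
have [cAX|/X_pseudoradial[x nAx sx]] := pselect (closed (e @^-1` A)); last first.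
  exists (e x) => //; apply: transfinite_sequence_cvg_image sx; first exact: ec.
  exact: image_preimage_subset.
have [cAK|/(well_order_pseudoradial _ _ K_wo)[k nAk sk]] :=
  pselect (closed (i @^-1` A)); last first.
  exists (i k) => //; apply: transfinite_sequence_cvg_image sk; first exact: ic.
  exact: image_preimage_subset.
pose B := e @^-1` A.
have clBX x : closure (e @` B) (e x) -> B x.
  move=> clBx; apply: cAX => N /(embedding_nbhs e e_emb)[V nV VN].
  have [_ [[b Bb <-] Vb]] := clBx _ nV.
  by exists b; split=> //; exact: VN.
have [|p [clBp nAp] pmin] := @well_order_min _ _ K_wo
    [set k | closure (e @` B) (i k) /\ ~ A (i k)].
  (* Without such a point, [A] would be the union of its two traces and contain the closures of
     both. *)
  apply: contrapT => nex; apply: nclA => y.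
  have -> : A = e @` B `|` i @` (i @^-1` A).
    apply/seteqP; split=> [z Az|z [[x Bx <-]|[k Ak <-]]] //.
    have [[x _ xz]|/iK[k zk]] := pselect (range e z).
      by left; exists x => //; rewrite /B /= xz.
    by right; exists k => //=; rewrite -zk.
  rewrite closureU => -[clBy|/(i_closed _ cAK)]; last by right.
  have [[x _ xy]|/iK[k yk]] := pselect (range e y).
    by left; exists x => //; apply: clBX; rewrite xy.
  right; exists k => //; apply: contrapT => nAk.
  by apply: nex; exists k; split=> //; rewrite -yk.
have [C [oC Cp CnA Cle _]] := well_order_nbhs_le K_wo p _
  (open_nbhs_nbhs (conj (closed_openC cAK) nAp)).
have nW : nbhs (i p) (~` (i @` (~` C))).
  apply: open_nbhs_nbhs; split.
    by apply: closed_openC; apply: i_closed; exact: open_closedC.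
  by move=> [k nCk /i_inj kp]; apply: nCk; rewrite kp.
(* Regularity of [Y] keeps even the closure of [W] away from the remainder outside [C]. *)
have [W nWp clW] := compact_regular hY cY filterT nW.
exists (i p) => //.
(* The map [id] only serves to enlarge the target set to [A]. *)
apply: (@transfinite_sequence_cvg_image _ _ id (e @` (B `&` e @^-1` W))) => //.
  by rewrite image_id => _ [x [Bx _] <-].
apply: radial_at_infinity_cvg => //.
  move=> O nO; have [_ [[b Bb <-] [Ob Wb]]] := clBp _ (filterI nO nWp).
  by exists (e b); split=> //; exists b.
move=> y cly; have [|/iK[k yk]] := pselect (range e y); first by right.
left; rewrite {}yk in cly *.
(* The choice of [W] puts [k] in [C], so [k <= p]; as [C] misses [A], minimality of [p] gives
   [p <= k]. *)
have Ck : C k.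
  apply: contrapT => nCk; apply: (clW (i k)); last by exists k.
  by apply: closureS cly => _ [x [_ Wx] <-].
have pk : (p <= k)%O.
  apply: pmin; split; last exact: CnA.
  by apply: closureS cly => _ [x [Bx _] <-]; exists x.
by congr i; apply/le_anti; rewrite pk Cle.
Qed.
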